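(* Let $d$ be a positive integer, let $0<p<2$, and assume that $N=kd$ for some positive integer $k$. Consider the $p$-frame potential $$\mathrm{FP}_{p,N}(\{x_i\}_{i=1}^N)=\sum_{i,j=1}^N|\langle x_i,x_j\rangle|^p$$ over all collections $\{x_i\}_{i=1}^N\subset S^{d-1}$ of $N$ unit vectors in $\mathbb{R}^d$. Then the minimizers of $\mathrm{FP}_{p,N}$ are exactly the collections consisting of $k$ copies of an (arbitrary) orthonormal basis of $\mathbb{R}^d$, modulo multiplications of the vectors by $\pm1$. The minimum of $\mathrm{FP}_{p,N}$ over all collections of $N=kd$ unit norm vectors is $k^2d$.
   Context: $S^{d-1}$ denotes the unit sphere of $\mathbb{R}^d$ with the standard inner product $\langle\cdot,\cdot\rangle$. Collections $\{x_i\}_{i=1}^N$ are indexed families, so repetitions are allowed and ordering is irrelevant. ''$k$ copies of an orthonormal basis modulo multiplications by $\pm1$'' means that there is an orthonormal basis $e_1,\dots,e_d$ of $\mathbb{R}^d$ such that each $x_i$ equals $e_j$ or $-e_j$ for some $j$, and for each $j$ exactly $k$ indices $i$ satisfy $x_i=\pm e_j$. *)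

(* Defs.v *)
From HB Require Import structures.
From mathcomp Require Import all_boot all_order all_algebra.
From mathcomp Require Import all_classical all_reals all_analysis.

Set Implicit Arguments.
Unset Strict Implicit.
Unset Printing Implicit Defensive.

Import Order.TTheory GRing.Theory Num.Theory.
Local Open Scope classical_set_scope.
Local Open Scope ring_scope.

Definition inner (R : realType) (d : nat) (u v : 'rV[R]_d) : R :=
  \sum_(l < d) u 0 l * v 0 l.

(* The Euclidean norm; the library norm on ['rV[R]_d] is the sup norm. *)
Definition enorm (R : realType) (d : nat) (u : 'rV[R]_d) : R :=
  Num.sqrt (inner u u).

Definition unit_sphere (R : realType) (d : nat) : set 'rV[R]_d :=
  [set u | enorm u = 1].

Definition on_sphere (R : realType) (d N : nat) (x : 'I_N -> 'rV[R]_d) : Prop :=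
  forall i, unit_sphere (x i).

(* For [p != 0], [0 `^ p = 0]. *)
Definition frame_potential (R : realType) (d N : nat) (p : R)
    (x : 'I_N -> 'rV[R]_d) : R :=
  \sum_(i < N) \sum_(j < N) `|inner (x i) (x j)| `^ p.

Definition is_minimizer (R : realType) (d N : nat) (p : R)
    (x : 'I_N -> 'rV[R]_d) : Prop :=
  on_sphere x /\
  forall y : 'I_N -> 'rV[R]_d, on_sphere y ->
    frame_potential p x <= frame_potential p y.

Definition is_orthonormal_basis (R : realType) (d : nat)
    (e : 'I_d -> 'rV[R]_d) : Prop :=
  basis_of fullv [seq e i | i : 'I_d] /\
  forall i j, inner (e i) (e j) = (i == j)%:R.

Definition is_copies_of_onb (R : realType) (d N k : nat)
    (x : 'I_N -> 'rV[R]_d) : Prop :=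
  exists e : 'I_d -> 'rV[R]_d,
    [/\ is_orthonormal_basis e,
        forall i, exists j, x i = e j \/ x i = - e j
      & forall j, #|[set i | (x i == e j) || (x i == - e j)]%SET| = k].

(* Main.v *)
Require Import Defs.
From HB Require Import structures.
From mathcomp Require Import all_boot all_order all_algebra.
From mathcomp Require Import all_classical all_reals all_analysis.
From mathcomp Require Import ring lra.

Set Implicit Arguments.
Unset Strict Implicit.
Unset Printing Implicit Defensive.

Import Order.TTheory GRing.Theory Num.Theory.
Local Open Scope classical_set_scope.
Local Open Scope ring_scope.

(** Write [x] for the family and [S = \sum_i x_i^T x_i] for its frame
    operator, a symmetric [d * d] matrix.  For unit vectors [S] has trace [N],
    and [\sum_(i, j) <x_i, x_j>^2] is the squared Frobenius norm of [S].
    Completing the square around the multiple [c I] of the identity with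
    [c = N / d = k] gives the Welch identity
      [\sum_(i, j) <x_i, x_j>^2 = k^2 d + |S - k I|^2]
    ([sum_sqr_inner]), so the potential with exponent 2 is at least [k^2 d].
    For [p < 2] the bound is inherited termwise: by Cauchy-Schwarz
    [t = |<x_i, x_j>|] lies in [[0, 1]], where [t^2 <= t^p]
    ([frame_potential_decomp], [frame_potential_ge]).

    If the value is exactly [k^2 d], both losses vanish.  First,
    [t^2 = t^p] with [p < 2] forces [t] to be 0 or 1, so any two vectors of
    the family are orthogonal or equal up to sign.  Second, [S = k I], that
    is, [\sum_i <x_i, v>^2 = k |v|^2] for every [v]; at [v = x_j] this sum
    counts the vectors equal to [x_j] up to sign, so each sign class has
    exactly [k] members ([equality_case]).  Hence there are [N / k = d]
    classes, and representatives of them are [d] orthonormal vectors, a basis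
    ([copies_of_classes]).  Conversely a direct count gives [k^2 d] for
    every such family ([copies_potential]), and [k] copies of the standard
    basis show that the value is attained. *)

(** * The inner product and unit vectors *)

Section Inner.
Context {R : realType} {d : nat}.
Implicit Types u v w : 'rV[R]_d.

Lemma innerC u v : inner u v = inner v u.
Proof. by apply: eq_bigr => l _; rewrite mulrC. Qed.

Lemma innerNr u v : inner u (- v) = - inner u v.
Proof. by rewrite /inner -sumrN; apply: eq_bigr => l _; rewrite mxE mulrN. Qed.

Lemma innerNl u v : inner (- u) v = - inner u v.
Proof. by rewrite innerC innerNr innerC. Qed.

Lemma innerDr u v w : inner u (v + w) = inner u v + inner u w.
Proof.
by rewrite /inner -big_split; apply: eq_bigr => l _; rewrite mxE mulrDr.
Qed.

Lemma innerDl u v w : inner (u + v) w = inner u w + inner v w.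
Proof. by rewrite innerC innerDr !(innerC w). Qed.

Lemma inner_suml I (r : seq I) (a : I -> R) (e : I -> 'rV[R]_d) v :
  inner (\sum_(i <- r) a i *: e i) v = \sum_(i <- r) a i * inner (e i) v.
Proof.
rewrite /inner; under [RHS]eq_bigr do rewrite mulr_sumr.
rewrite exchange_big; apply: eq_bigr => l _.
by rewrite summxE mulr_suml; apply: eq_bigr => i _; rewrite mxE mulrA.
Qed.

Lemma inner_ge0 u : 0 <= inner u u.
Proof. by apply: sumr_ge0 => l _; rewrite -expr2 sqr_ge0. Qed.

Lemma inner_eq0 u : inner u u = 0 -> u = 0.
Proof.
move=> /psumr_eq0P u0; apply/rowP => l; rewrite mxE; apply/eqP.
by rewrite -sqrf_eq0 expr2 u0// => m _; rewrite -expr2 sqr_ge0.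
Qed.

Lemma unit_sphereE u : unit_sphere u <-> inner u u = 1.
Proof.
rewrite /unit_sphere /enorm /=; split=> [u1|->]; last exact: sqrtr1.
by rewrite -[LHS]sqr_sqrtr ?inner_ge0// u1 expr1n.
Qed.

Definition eq_sign u v := (u == v) || (u == - v).

Lemma eq_sign_equiv : equivalence_rel eq_sign.
Proof.
move=> u v w; rewrite /eq_sign eqxx; split=> // /orP[]/eqP-> //.
by rewrite eqr_opp eqr_oppLR orbC.
Qed.

Lemma eq_sign_sym u v : eq_sign u v = eq_sign v u.
Proof. by rewrite /eq_sign eq_sym [u == - v]eq_sym eqr_oppLR. Qed.

Lemma unit_inner_le1 u v : inner u u = 1 -> inner v v = 1 ->
  `|inner u v| <= 1.
Proof.
move=> u1 v1; rewrite ler_norml.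
have := inner_ge0 (u - v); have := inner_ge0 (u + v).
rewrite !(innerDl, innerDr, innerNl, innerNr) u1 v1 (innerC v u).
by move=> h1 h2; apply/andP; split; lra.
Qed.

(** The equality case of Cauchy-Schwarz for unit vectors: then [u - v] or
    [u + v] has norm zero. *)
Lemma unit_inner_eq1 u v : inner u u = 1 -> inner v v = 1 ->
  (`|inner u v| == 1) = eq_sign u v.
Proof.
move=> u1 v1; apply/idP/idP; last first.
  by case/orP => /eqP->; rewrite ?innerNl ?normrN v1 normr1.
rewrite eqr_norml ler01 andbT /eq_sign => /orP[]/eqP uv; apply/orP;
  [left|right]; rewrite -subr_eq0 ?opprK; apply/eqP/inner_eq0;
  by rewrite !(innerDl, innerDr, innerNl, innerNr) u1 v1 (innerC v u) uv; lra.
Qed.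

(** Orthonormal vectors are free, since the inner product of a linear
    combination with [e i] recovers its [i]-th coefficient. *)
Lemma orthonormal_basis (e : 'I_d -> 'rV[R]_d) :
  (forall i j, inner (e i) (e j) = (i == j)%:R) -> is_orthonormal_basis e.
Proof.
move=> eON; split=> //.
have sz : size [seq e i | i : 'I_d] == d by rewrite size_map size_enum_ord.
rewrite basisEfree subvf (eqP sz) dimvf dim_matrix mul1r leqnn !andbT.
apply/(@freeP _ _ _ (Tuple sz)) => a a0 i /=.
have {}a0 : \sum_(i < d) a i *: e i = 0.
  rewrite -[RHS]a0; apply: eq_bigr => j _; congr (_ *: _).
  by rewrite /= (nth_map j) ?size_enum_ord// nth_ord_enum.
have := inner_suml (index_enum 'I_d) a e (e i).
rewrite a0 (bigD1 i)//= eON eqxx mulr1 big1 ?addr0 => [<-|j ji].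
  by rewrite /inner big1// => l _; rewrite mxE mul0r.
by rewrite eON (negbTE ji) mulr0.
Qed.

End Inner.

(** * The frame operator and the Welch identity *)

Section FrameOperator.
Context {R : realType} {d N : nat}.
Implicit Type x : 'I_N -> 'rV[R]_d.

Definition frame_operator x : 'M[R]_d :=
  \matrix_(l, m) \sum_(i < N) x i 0 l * x i 0 m.

Lemma sum_sqr_inner_frame x v : \sum_(i < N) inner (x i) v ^+ 2 =
  \sum_(l < d) \sum_(m < d) frame_operator x l m * (v 0 l * v 0 m).
Proof.
under eq_bigr => i _.
  rewrite expr2 {1}/inner mulr_suml.
  under eq_bigr => l _ do rewrite /inner mulr_sumr.
  over.
rewrite exchange_big; apply: eq_bigr => l _; rewrite exchange_big.
apply: eq_bigr => m _; rewrite mxE mulr_suml.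
by apply: eq_bigr => i _; rewrite mulrACA.
Qed.

Lemma frame_operator_trace x : on_sphere x ->
  \sum_(l < d) frame_operator x l l = N%:R.
Proof.
move=> x1; under eq_bigr do rewrite mxE.
rewrite exchange_big -[N in RHS]card_ord -sum1_card natr_sum.
by apply: eq_bigr => i _; exact/unit_sphereE.
Qed.

Definition frame_defect (c : R) x : R :=
  \sum_(l < d) \sum_(m < d) (frame_operator x l m - c *+ (l == m)) ^+ 2.

Lemma frame_defect_ge0 c x : 0 <= frame_defect c x.
Proof. by apply: sumr_ge0 => l _; apply: sumr_ge0 => m _; exact: sqr_ge0. Qed.

Lemma frame_defect_eq0 c x : frame_defect c x = 0 ->
  forall l m, frame_operator x l m = c *+ (l == m).
Proof.
move=> /psumr_eq0P h l m; apply/eqP; rewrite -subr_eq0 -sqrf_eq0; apply/eqP.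
have /psumr_eq0P -> // : \sum_(m < d)
    (frame_operator x l m - c *+ (l == m)) ^+ 2 = 0.
  by apply: h => // i _; apply: sumr_ge0 => j _; exact: sqr_ge0.
by move=> j _; exact: sqr_ge0.
Qed.

(** The left-hand side is the squared Frobenius norm of the frame operator [S],
    both being the sum of [x i l * x i m * x j l * x j m] over [i, j, l, m];
    the rest is completing the square, the cross term being a multiple of the
    trace of [S], which is [N]. *)
Lemma sum_sqr_inner (c : R) x : on_sphere x ->
  \sum_(i < N) \sum_(j < N) inner (x i) (x j) ^+ 2 =
  (c * N%:R) *+ 2 - c ^+ 2 * d%:R + frame_defect c x.
Proof.
move=> x1.
have -> : \sum_(i < N) \sum_(j < N) inner (x i) (x j) ^+ 2 =
    \sum_(l < d) \sum_(m < d) frame_operator x l m ^+ 2.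
  rewrite exchange_big; under eq_bigr do rewrite sum_sqr_inner_frame.
  rewrite exchange_big; apply: eq_bigr => l _; rewrite exchange_big.
  apply: eq_bigr => m _; rewrite -mulr_sumr expr2; congr (_ * _).
  by rewrite mxE.
have -> : frame_defect c x =
    \sum_(l < d) (\sum_(m < d) frame_operator x l m ^+ 2
                  + (c ^+ 2 - (c * frame_operator x l l) *+ 2)).
  apply: eq_bigr => l _; rewrite (bigD1 l)//= [in RHS](bigD1 l)//= eqxx mulr1n.
  rewrite (eq_bigr (fun m => frame_operator x l m ^+ 2)); first by ring.
  by move=> m; rewrite eq_sym => /negbTE->; rewrite subr0.
rewrite big_split/= sumrB sumr_const card_ord sumrMnl -mulr_sumr.
by rewrite frame_operator_trace// -[c ^+ 2 *+ d]mulr_natr; ring.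
Qed.

End FrameOperator.

(** * The lower bound *)

Section UnitInterval.
Context {R : realType}.
Implicit Types t p : R.

Lemma sqr_le_powR t p : p < 2 -> 0 < p -> 0 <= t <= 1 -> t ^+ 2 <= t `^ p.
Proof.
move=> p2 p0 /andP[]; rewrite le_eqVlt => /predU1P[<- _|t0 t1].
  by rewrite expr0n powR_ge0.
by rewrite -powR_mulrn ?(ltW t0)// ger_powR ?t0// ltW.
Qed.

(** Strictness of the comparison away from 0 and 1: taking logarithms,
    [t^2 = t^p] says [(2 - p) ln t = 0]. *)
Lemma sqr_eq_powR t p : p < 2 -> 0 <= t -> t ^+ 2 = t `^ p -> t = 0 \/ t = 1.
Proof.
move=> p2; rewrite le_eqVlt => /predU1P[<-|t0]; first by left.
rewrite -powR_mulrn ?(ltW t0)// => /(congr1 (@ln R)); rewrite !ln_powR => tp.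
right; apply/eqP; rewrite -ln_eq0//.
have /eqP : (2 - p) * ln t = 0 by rewrite mulrBl tp subrr.
by rewrite mulf_eq0 subr_eq0 gt_eqF.
Qed.

End UnitInterval.

Section Potential.
Context {R : realType} {d k : nat} {p : R}.
Hypotheses (p_gt0 : 0 < p) (p_lt2 : p < 2).
Implicit Type x : 'I_(k * d) -> 'rV[R]_d.

(** The two nonnegative losses: one for replacing the exponent [p] by 2, and one
    for the distance of the frame operator to [k I]. *)
Lemma frame_potential_decomp x : on_sphere x ->
  frame_potential p x = (k ^ 2 * d)%:R + frame_defect k%:R x +
    \sum_(i < k * d) \sum_(j < k * d)
      (`|inner (x i) (x j)| `^ p - inner (x i) (x j) ^+ 2).
Proof.
move=> x1; under eq_bigr do rewrite sumrB.
rewrite sumrB (sum_sqr_inner k%:R x1) /frame_potential !natrM; ring.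
Qed.

Lemma powR_inner_loss_ge0 x i j : on_sphere x ->
  0 <= `|inner (x i) (x j)| `^ p - inner (x i) (x j) ^+ 2.
Proof.
move=> x1; rewrite subr_ge0 -real_normK ?num_real//.
by rewrite sqr_le_powR// normr_ge0 unit_inner_le1//; exact/unit_sphereE.
Qed.

Lemma frame_potential_ge x : on_sphere x ->
  (k ^ 2 * d)%:R <= frame_potential p x.
Proof.
move=> x1; rewrite frame_potential_decomp// -addrA lerDl.
rewrite addr_ge0 ?frame_defect_ge0//; do 2!apply: sumr_ge0 => ? _.
exact: powR_inner_loss_ge0.
Qed.

(** * Families attaining the bound *)

(** Orthogonality off the sign classes comes from the vanishing loss in the
    exponent; the class sizes come from the frame operator being [k I],
    evaluated at the members of the family. *)
Lemma equality_case x : on_sphere x ->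
  frame_potential p x = (k ^ 2 * d)%:R ->
  (forall i j, `|inner (x i) (x j)| = (eq_sign (x i) (x j))%:R) /\
  (forall i, #|[set j | eq_sign (x i) (x j)]%SET| = k).
Proof.
move=> x1 fpx; have x1' i : inner (x i) (x i) = 1 by exact/unit_sphereE.
have loss0 := fun i j => powR_inner_loss_ge0 i j x1.
have sum0 i : 0 <= \sum_(j < k * d)
    (`|inner (x i) (x j)| `^ p - inner (x i) (x j) ^+ 2).
  exact: sumr_ge0.
have /eqP : frame_defect k%:R x + \sum_(i < k * d) \sum_(j < k * d)
    (`|inner (x i) (x j)| `^ p - inner (x i) (x j) ^+ 2) = 0.
  by apply: (addrI (k ^ 2 * d)%:R); rewrite addr0 addrA -frame_potential_decomp.
rewrite paddr_eq0 ?frame_defect_ge0 ?sumr_ge0//.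
case/andP => /eqP /frame_defect_eq0 Sk /eqP /psumr_eq0P loss.
have abs01 i j : `|inner (x i) (x j)| = (eq_sign (x i) (x j))%:R.
  rewrite -unit_inner_eq1//.
  have /psumr_eq0P h := loss (fun i _ => sum0 i) i isT.
  have /eqP := h (fun j _ => loss0 i j) j isT.
  rewrite subr_eq0 -real_normK ?num_real// => /eqP/esym/sqr_eq_powR.
  by case=> // ->; rewrite ?eqxx// eq_sym oner_eq0.
split=> // i; apply/eqP; rewrite -(eqr_nat R); apply/eqP.
transitivity (\sum_(j < k * d) inner (x j) (x i) ^+ 2).
  rewrite -sum1_card natr_sum big_mkcond; apply: eq_bigr => j _.
  by rewrite inE innerC -real_normK ?num_real// abs01 -natrX; case: eq_sign.
transitivity (k%:R * inner (x i) (x i)); last by rewrite x1' mulr1.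
rewrite sum_sqr_inner_frame /inner mulr_sumr.
apply: eq_bigr => l _; rewrite (bigD1 l)//= Sk eqxx big1 ?addr0// => m.
by rewrite Sk eq_sym => /negbTE->; rewrite mul0r.
Qed.

(** The [k * d] indices split into sign classes of size [k], hence into [d]
    classes; one vector from each class gives the basis. *)
Lemma copies_of_classes x : (0 < k)%N ->
  (forall i j, `|inner (x i) (x j)| = (eq_sign (x i) (x j))%:R) ->
  on_sphere x -> (forall i, #|[set j | eq_sign (x i) (x j)]%SET| = k) ->
  is_copies_of_onb k x.
Proof.
move=> k_gt0 abs01 x1 classk.
pose E := [rel i j | eq_sign (x i) (x j)].
have eqE : {in [set: 'I_(k * d)]%SET & &, equivalence_rel E}.
  by move=> i j l _ _ _; exact: eq_sign_equiv.
pose P := equivalence_partition E [set: 'I_(k * d)]%SET.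
have partP : finset.partition P [set: 'I_(k * d)]%SET.
  exact: equivalence_partitionP.
have trP := transversalP partP; set T := transversal _ _ in trP.
have cardT : d = #|T|.
  rewrite (card_transversal trP); apply/eqP; rewrite -(eqn_pmul2r k_gt0).
  rewrite -(card_uniform_partition _ partP) ?cardsT ?card_ord ?[(d * k)%N]mulnC//.
  move=> _ /imsetP[i _ ->]; rewrite -[RHS](classk i).
  by apply: eq_card => j; rewrite !inE.
have pblockE i j : (j \in finset.pblock P i) = E i j.
  by rewrite pblock_equivalence_partition ?inE.
pose r (j : 'I_d) : 'I_(k * d) := enum_val (cast_ord cardT j).
have rT j : r j \in T by exact: enum_valP.
have r_inj i j : E (r i) (r j) -> i = j.
  rewrite -pblockE => rij; apply/(@cast_ord_inj _ _ cardT)/enum_val_inj.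
  apply: (pblock_inj trP); rewrite ?rT//; apply/esym/same_pblock => //.
  exact: partition_trivIset partP.
have r_surj i : exists j, E (r j) i.
  have /imsetP[t tT Pt] : finset.pblock P i \in [set finset.pblock P t | t in T]%SET.
    by rewrite (pblock_transversal trP) pblock_mem// (cover_partition partP) inE.
  exists (cast_ord (esym cardT) (enum_rank_in tT t)).
  rewrite -pblockE /r cast_ordKV enum_rankK_in// -Pt.
  by rewrite mem_pblock (cover_partition partP) inE.
exists (x \o r); split=> /=.
- apply: orthonormal_basis => i j /=; have [->|ij] := eqVneq i j.
    exact/unit_sphereE.
  apply/eqP; rewrite -normr_eq0 abs01 pnatr_eq0 eqb0.
  by apply: contra ij => /r_inj->.
- move=> i; have [j rji] := r_surj i; exists j; move: rji.
  by rewrite /= eq_sign_sym => /orP[]/eqP; [left|right].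
- move=> j; rewrite -[RHS](classk (r j)); apply: eq_card => i.
  by rewrite !inE eq_sign_sym.
Qed.

(** Each vector [x i] is [e j] up to sign for one [j]; its [k] companions
    contribute 1 each to the [i]-th row of the double sum, all other terms
    vanish. *)
Lemma copies_potential x : is_copies_of_onb k x ->
  on_sphere x /\ frame_potential p x = (k ^ 2 * d)%:R.
Proof.
case=> e [[_ eON] xe ek].
have abs i j v : x i = e j \/ x i = - e j ->
    `|inner (x i) v| = `|inner (e j) v|.
  by case=> ->; rewrite ?innerNl ?normrN.
have e01 j m : `|inner (e j) (x m)| = (eq_sign (x m) (e j))%:R.
  have [l xl] := xe m; rewrite innerC (abs _ _ _ xl) eON normr_nat.
  rewrite -unit_inner_eq1 ?eON ?eqxx//.
    by rewrite (abs _ _ _ xl) eON normr_nat pnatr_eq1 eqb1.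
  by case: xl => ->; rewrite ?innerNl ?innerNr ?opprK eON eqxx.
have x1 : on_sphere x.
  move=> i; apply/unit_sphereE; have [j [] ->] := xe i;
  by rewrite ?innerNl ?innerNr ?opprK eON eqxx.
split=> //; rewrite /frame_potential.
rewrite (eq_bigr (fun=> k%:R)) => [|i _].
  by rewrite sumr_const card_ord -mulrnA mulnA.
have [j xj] := xe i; rewrite -[in RHS](ek j) -sum1_card natr_sum [RHS]big_mkcond.
apply: eq_bigr => m _; rewrite (abs _ _ _ xj) e01 inE /eq_sign.
by case: ifP => _; rewrite ?powR1// powR0// gt_eqF.
Qed.

End Potential.

(** The index set is identified with ['I_k * 'I_d], so that the second component
    selects the basis vector. *)
Lemma copies_exist (R : realType) (d k : nat) :
  exists x : 'I_(k * d) -> 'rV[R]_d, is_copies_of_onb k x.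
Proof.
have cardkd : (k * d)%N = #|{: 'I_k * 'I_d}| by rewrite card_prod !card_ord.
pose f (i : 'I_(k * d)) : 'I_k * 'I_d := enum_val (cast_ord cardkd i).
have f_bij : bijective f.
  exists (fun c => cast_ord (esym cardkd) (enum_rank c)) => i.
    by rewrite /f enum_valK cast_ordK.
  by rewrite /f cast_ordKV enum_rankK.
pose e (j : 'I_d) : 'rV[R]_d := delta_mx 0 j.
have eON i j : inner (e i) (e j) = (i == j)%:R.
  rewrite /inner (bigD1 i)//= big1 ?addr0 => [|l /negbTE li].
    by rewrite !mxE !eqxx mul1r.
  by rewrite !mxE li mul0r.
exists (fun i => e (f i).2); exists e; split.
- exact: orthonormal_basis.
- by move=> i; exists (f i).2; left.
move=> j; have -> : [set i | (e (f i).2 == e j) || (e (f i).2 == - e j)]%SET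
    = (f @^-1: [set c | c.2 == j])%SET.
  apply/setP => i; rewrite !inE -[LHS]unit_inner_eq1 ?eON ?eqxx//.
  by rewrite normr_nat pnatr_eq1 eqb1.
rewrite on_card_preimset; last exact: onW_bij.
have -> : [set c : 'I_k * 'I_d | c.2 == j]%SET = finset.setX [set: 'I_k]%SET [set j]%SET.
  by apply/setP => -[a b]; rewrite !inE.
by rewrite cardsX cardsT cards1 card_ord muln1.
Qed.

Theorem theorem3p5 (R : realType) (d k N : nat) (p : R)
    (hd : (0 < d)%N) (hk : (0 < k)%N) (hN : N = (k * d)%N)
    (hp0 : 0 < p) (hp2 : p < 2) :
  (forall x : 'I_N -> 'rV[R]_d, is_minimizer p x <-> is_copies_of_onb k x) /\
  (exists x : 'I_N -> 'rV[R]_d,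
     on_sphere x /\ frame_potential p x = (k ^ 2 * d)%:R) /\
  (forall x : 'I_N -> 'rV[R]_d,
     on_sphere x -> (k ^ 2 * d)%:R <= frame_potential p x).
Proof.
subst N; have [z zcopies] := copies_exist R d k.
have [z1 zmin] := copies_potential hp0 zcopies.
split; last by split; [exists z | move=> x; exact: frame_potential_ge].
move=> x; split=> [[x1 xmin]|/(copies_potential hp0)[x1 fpx]]; last first.
  by split=> // y y1; rewrite fpx frame_potential_ge.
have fpx : frame_potential p x = (k ^ 2 * d)%:R.
  by apply/le_anti; rewrite frame_potential_ge// -zmin xmin.
have [abs01 classk] := equality_case hp0 hp2 x1 fpx.
exact: copies_of_classes.
Qed.
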